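(* All idempotents split in $\mathsf{PS(BorelStoch)}$: for every standard Borel probability space $(X,p)$ and every morphism $e:(X,p)\to(X,p)$ of $\mathsf{PS(BorelStoch)}$ with $e\circ e\simeq_p e$, there exist a standard Borel probability space $(E,q)$ and morphisms $\pi:(X,p)\to(E,q)$ and $\iota:(E,q)\to(X,p)$ of $\mathsf{PS(BorelStoch)}$ such that $\iota\circ\pi\simeq_p e$ and $\pi\circ\iota\simeq_q\mathrm{id}_E$.
   Context: A Markov kernel $k:X\to Y$ between measurable spaces assigns to $x\in X$ and measurable $B\subseteq Y$ a number $k(B|x)\in[0,1]$, being a probability measure in $B$ and measurable in $x$; composition is $(h\circ k)(C|x)=\int_Y h(C|y)\,k(dy|x)$, and identities are $(B,x)\mapsto 1_B(x)$. For a probability measure $p$ on $X$, kernels $f,g:X\to Y$ are $p$-almost surely equal, $f\simeq_p g$, if $\int_A f(B|x)\,p(dx)=\int_A g(B|x)\,p(dx)$ for all measurable $A\subseteq X$, $B\subseteq Y$. The category $\mathsf{PS(BorelStoch)}$ has standard Borel probability spaces $(X,p)$ as objects; morphisms $(X,p)\to(Y,q)$ are $p$-a.s. equality classes of Markov kernels $f:X\to Y$ with $q(B)=\int_X f(B|x)\,p(dx)$ for all measurable $B\subseteq Y$. *)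

(* Defs.v *)
From HB Require Import structures.
From mathcomp Require Import all_boot all_order all_algebra.
From mathcomp Require Import all_classical all_reals all_analysis.

Set Implicit Arguments.
Unset Strict Implicit.
Unset Printing Implicit Defensive.
Import Order.TTheory GRing.Theory Num.Theory.

Local Open Scope classical_set_scope.
Local Open Scope ring_scope.
Local Open Scope ereal_scope.

(* A complete separable metric space. Completeness is stated for Cauchy filters
   because the library's completeType also requires a distinguished point. *)
Definition polish_metric (R : realType) (M : metricType R) : Prop :=
  (forall F : set_system M, ProperFilter F -> cauchy F ->
     exists l : M, F --> l) /\
  (exists2 S : set M, countable S & dense S).

(* The sigma-algebra of X is the Borel sigma-algebra of some Polish topology
   on X. The topology is carried by a type M in bijection with X, which avoids
   a second bundled structure on X itself. *)
Definition standard_borel (R : realType) d (X : measurableType d) : Prop :=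
  exists (M : metricType R) (f : X -> M),
    [/\ polish_metric M, bijective f &
        (measurable : set_system X) =
          preimage_set_system [set: X] f <<s [set U : set M | open U] >>].

Section pker_comp.
Context d1 d2 d3 (X : measurableType d1) (Y : measurableType d2)
  (Z : measurableType d3) (R : realType).
Variables (k : R.-pker X ~> Y) (h : R.-pker Y ~> Z).

Let prob_mkcomp_noparam x : mkcomp_noparam k h x [set: Z] = 1.
Proof.
rewrite /mkcomp_noparam /= /kcomp_noparam.
rewrite (eq_integral (cst 1)); last by move=> y _; rewrite prob_kernel.
by rewrite integral_cst// mul1e prob_kernel.
Qed.

HB.instance Definition _ := isProbabilityKernel.Build _ _ X Z R
  (mkcomp_noparam k h) prob_mkcomp_noparam.

End pker_comp.

(* h after k; mkcomp_noparam takes its arguments in diagrammatic order. *)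
Definition pker_comp d1 d2 d3 (X : measurableType d1) (Y : measurableType d2)
    (Z : measurableType d3) (R : realType)
    (h : R.-pker Y ~> Z) (k : R.-pker X ~> Y) : R.-pker X ~> Z :=
  mkcomp_noparam k h.

Definition pker_id d (X : measurableType d) (R : realType) : R.-pker X ~> X :=
  kdirac (@measurable_id _ X [set: X]).

Definition as_eq d1 d2 (X : measurableType d1) (Y : measurableType d2)
    (R : realType) (p : probability X R) (f g : R.-pker X ~> Y) : Prop :=
  forall (A : set X) (B : set Y), measurable A -> measurable B ->
    \int[p]_(x in A) f x B = \int[p]_(x in A) g x B.

(* f represents a morphism (X, p) -> (Y, q) of PS(BorelStoch); the morphism
   is the class of f modulo as_eq p. *)
Definition ps_hom d1 d2 (X : measurableType d1) (Y : measurableType d2)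
    (R : realType) (p : probability X R) (q : probability Y R)
    (f : R.-pker X ~> Y) : Prop :=
  forall B : set Y, measurable B -> q B = \int[p]_x f x B.

(* Main.v *)
Require Import Defs.
From HB Require Import structures.
From mathcomp Require Import all_boot all_order all_algebra.
From mathcomp Require Import all_classical all_reals all_analysis.
From mathcomp Require Import measurable_realfun.

Set Implicit Arguments.
Unset Strict Implicit.
Unset Printing Implicit Defensive.
Import Order.TTheory GRing.Theory Num.Theory.

Local Open Scope classical_set_scope.
Local Open Scope ring_scope.
Local Open Scope ereal_scope.

(** Write T for the Markov operator of [e]. As T preserves p and T u >= u can
    hold a.e. only with equality when u is nonnegative and integrable, applying
    this to u = (f - r)^+ with f = e(., B) = T f shows that every level set
    D = {f > r} is invariant: for p-almost all x, e(x, .) is concentrated on D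
    or on its complement according to whether x is in D. Letting B run over a
    countable generating pi-system and r over the rationals gives countably
    many invariant sets D_t, and two points in exactly the same D_t have one law
    under [e].

    The splitting takes place on E = X. One selects measurably a point s(x)
    that depends on x only through the measure e(x, .) and lies in the same
    D_t as x for almost all x: cover X, up to a p-null set, by countably many
    closed sets of diameter at most 2/(n+1), each contained in D_n or in its
    complement, and at stage n pick the first of them that keeps positive
    e(x, .)-measure after intersection with the sets already picked; by
    completeness the nested sets shrink to a point s(x), and each chosen set
    lies on the same side of D_n as x because it is not e(x, .)-null. Then
    e(s(x), .) = e(x, .) and s is e(x, .)-a.s. equal to s(x), so q = s_* p,
    pi = dirac o s and iota = e split [e]. *)

(** * Preliminaries: continuity from above and separability *)

Lemma measure_nonincreasing_lt (R : realType) d (T : measurableType d)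
    (mu : {finite_measure set T -> \bar R}) (A : (set T)^nat) (eps : \bar R) :
  (forall n, measurable (A n)) ->
  nonincreasing_seq A -> mu (\bigcap_n A n) < eps ->
  exists n, mu (A n) < eps.
Proof.
move=> mA niA lt_eps.
have mI : measurable (\bigcap_n A n) by exact: bigcapT_measurable.
have A0oo : mu (A 0%N) < +oo by rewrite ltey_eq fin_num_measure.
have cvgA := nonincreasing_cvg_mu A0oo mA mI niA.
apply: contrapT => /forallNP ge_eps; move: lt_eps; apply/negP; rewrite -leNgt.
rewrite -(cvg_lim _ cvgA)//; apply: lime_ge.
  by apply/cvg_ex; eexists; exact: cvgA.
by apply: nearW => n; rewrite leNgt; apply/negP; exact: ge_eps.
Qed.

Lemma inv_natS_lt (R : realType) (eps : R) :
  (0 < eps)%R -> exists n : nat, (n.+1%:R^-1 < eps)%R.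
Proof.
move=> eps0; have [N _ /(_ N (leqnn N))] := near_infty_natSinv_lt (PosNum eps0).
by exists N.
Qed.

(** [x0] is the value at indices that the injection of [S] into [nat] misses. Interiors of balls are
    used so that the covering sets are open by construction. *)
Lemma separable_sequence (R : realType) (M : metricType R) (S : set M)
    (x0 : M) :
  countable S -> dense S ->
  exists c : nat -> M,
    forall x (eps : R), (0 < eps)%R -> exists j, interior (ball (c j) eps) x.
Proof.
move=> /countable_injP[g ginj] dS.
exists (fun n => xget x0 [set s | S s /\ g s = n]) => x eps eps0.
have e20 : (0 < eps / 2)%R by rewrite divr_gt0.
have [||s [/interior_subset xs Ss]] := dS (interior (ball x (eps / 2))).
- by exists x; exact: nbhsx_ballx.
- exact: open_interior.
exists (g s); case: xgetP => [_ -> [Sy gy]|/(_ s)]; last by case; split.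
rewrite (ginj _ _ _ _ gy) ?inE//.
apply/nbhs_ballP; exists (eps / 2)%R => //= y xy.
by apply: (@ball_splitr _ _ x).
Qed.

(** * Inner regularity of probability measures by closed sets *)

Section standard_borel_space.
Context (R : realType) d (X : measurableType d) (M : metricType R) (f : X -> M).
Hypothesis mX : (measurable : set_system X) =
  preimage_set_system [set: X] f <<s [set U : set M | open U] >>.

Lemma measurable_preimage_open (U : set M) : open U -> measurable (f @^-1` U).
Proof.
move=> oU; rewrite mX; exists U; last by rewrite setTI.
exact: sub_sigma_algebra.
Qed.

Lemma measurable_preimage_closed (K : set M) :
  closed K -> measurable (f @^-1` K).
Proof.
move=> cK; rewrite -[K]setCK -preimage_setC; apply: measurableC.
by apply: measurable_preimage_open; exact: closed_openC.
Qed.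

Lemma measurable_preimage_setD (A K : set M) :
  measurable (f @^-1` A) -> closed K -> measurable (f @^-1` (A `\` K)).
Proof.
by move=> mA cK; apply: measurableD => //; exact: measurable_preimage_closed.
Qed.

(** The sets live in [M] and are measured through [f], because topology is available on [M] only and
    [p] on [X] only. *)
Definition closed_regular (p : set X -> \bar R) (A : set M) :=
  forall eps : R, (0 < eps)%R ->
    exists K, [/\ closed K, K `<=` A & p (f @^-1` (A `\` K)) < eps%:E].

(** The complement of the open neighbourhood [W n] of the complement of [U], of radius [1/(n+1)], is
    closed and contained in [U]. Since [U] is open, these closed sets exhaust it, and continuity
    from above gives the bound. *)
Lemma closed_regular_open (p : probability X R) (U : set M) :
  open U -> closed_regular p U.
Proof.
move=> oU eps eps0.
pose W n := \bigcup_(y in ~` U) interior (ball y (n.+1%:R^-1 : R)).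
have oW n : open (W n).
  by apply: bigcup_open => y _; exact: open_interior.
have WU n : ~` W n `<=` U.
  move=> x /= nWx; apply: contrapT => nUx; apply: nWx; exists x => //.
  by apply: nbhsx_ballx; rewrite invr_gt0 ltr0n.
have [|||n ltn] := @measure_nonincreasing_lt _ _ _ p
    (fun n => f @^-1` (U `\` ~` W n)) eps%:E.
- move=> n; rewrite setDE setCK preimage_setI.
  by apply: measurableI; exact: measurable_preimage_open.
- move=> m n mn; apply/subsetPset => x [Ux]; rewrite /= notK => -[y nUy yx].
  split => //=; rewrite notK; exists y => //.
  move: yx; apply: interiorS; apply: le_ball.
  by rewrite lef_pV2 ?posrE ?ltr0n// ler_nat.
- rewrite (_ : \bigcap_n _ = set0) ?measure0 ?lte_fin//.
  rewrite -subset0 => x Wx.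
  have [Ux _] := Wx 0%N I.
  have /nbhs_ballP[e /= e0 xeU] : nbhs (f x) U by exact: open_nbhs_nbhs.
  have [n ne] := inv_natS_lt e0.
  have [_] := Wx n I; rewrite /= notK => -[y nUy /interior_subset yx].
  apply: nUy; apply: xeU; apply: ball_sym; apply: le_ball yx.
  exact: ltW.
- by exists (~` W n); split => //; exact: open_closedC.
Qed.

Lemma closed_regular_bigcap (p : probability X R) (A : nat -> set M) :
  (forall n, measurable (f @^-1` A n)) -> (forall n, closed_regular p (A n)) ->
  closed_regular p (\bigcap_n A n).
Proof.
move=> mA rA eps eps0.
(* These errors sum to [eps / 2]; the spare half restores the strict inequality, which a series of
   strict bounds does not give. *)
have /choice[K KP] n : exists K, [/\ closed K, K `<=` A n &
    p (f @^-1` (A n `\` K)) < (eps / 2 / (2 ^ n.+1)%:R)%:E].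
  by apply: rA; rewrite !divr_gt0// ltr0n expn_gt0.
exists (\bigcap_n K n); split.
- by apply: closed_bigI => n _; have [] := KP n.
- by apply: subset_bigcap => n _; have [] := KP n.
have mAK n : measurable (f @^-1` (A n `\` K n)).
  by apply: measurable_preimage_setD => //; have [] := KP n.
apply: (@le_lt_trans _ _ (\sum_(n <oo) p (f @^-1` (A n `\` K n)))).
  apply: measure_sigma_subadditive => //.
    apply: measurable_preimage_setD.
      by rewrite preimage_bigcap; exact: bigcapT_measurable.
    by apply: closed_bigI => n _; have [] := KP n.
  move=> x [Ax nKx].
  have /existsNP[n /not_implyP[_ nKn]] := nKx.
  by exists n => //; split => //; exact: Ax.
apply: (@le_lt_trans _ _ (eps / 2)%:E); last first.
  by rewrite lte_fin ltr_pdivrMr// ltr_pMr// ltr1n.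
apply: (@le_trans _ _ (\sum_(n <oo) (eps / 2 / (2 ^ n.+1)%:R)%:E)).
  by apply: lee_nneseries => // n _; have [_ _ /ltW] := KP n.
by apply: epsilon_trick0; rewrite divr_ge0// ltW.
Qed.

(** A countable union of closed sets need not be closed, so the union of the [K n] is truncated to
    the finite union [L n]. Continuity from above makes the loss small for some [n]. *)
Lemma closed_regular_bigcup (p : probability X R) (A : nat -> set M) :
  (forall n, measurable (f @^-1` A n)) -> (forall n, closed_regular p (A n)) ->
  closed_regular p (\bigcup_n A n).
Proof.
move=> mA rA eps eps0.
have /choice[K KP] n : exists K, [/\ closed K, K `<=` A n &
    p (f @^-1` (A n `\` K)) < (eps / 2 / (2 ^ n.+1)%:R)%:E].
  by apply: rA; rewrite !divr_gt0// ltr0n expn_gt0.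
pose L n := \big[setU/set0]_(i < n) K i.
have cL n : closed (L n).
  by apply: closed_bigsetU => i _; have [] := KP i.
have mU : measurable (f @^-1` \bigcup_n A n).
  by rewrite preimage_bigcup; exact: bigcupT_measurable.
have mAK n : measurable (f @^-1` (A n `\` K n)).
  by apply: measurable_preimage_setD => //; have [] := KP n.
have mUL n : measurable (f @^-1` ((\bigcup_n A n) `\` L n)).
  exact: measurable_preimage_setD.
have [|||n ltn] := @measure_nonincreasing_lt _ _ _ p
    (fun n => f @^-1` ((\bigcup_n A n) `\` L n)) eps%:E => //.
- move=> m n mn; apply/subsetPset => x [Ux nLx]; split => // Lx; apply: nLx.
  by move: Lx; apply: subset_bigsetU.
- apply: (@le_lt_trans _ _ (\sum_(n <oo) p (f @^-1` (A n `\` K n)))).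
    apply: measure_sigma_subadditive => //; first exact: bigcapT_measurable.
    move=> x UL; have [[n _ Ax] _] := UL 0%N I.
    exists n => //; split => //= Kx.
    have [_] := UL n.+1 I; apply; rewrite /L.
    by apply: (@bigsetU_sup _ n).
  apply: (@le_lt_trans _ _ (eps / 2)%:E); last first.
    by rewrite lte_fin ltr_pdivrMr// ltr_pMr// ltr1n.
  apply: (@le_trans _ _ (\sum_(n <oo) (eps / 2 / (2 ^ n.+1)%:R)%:E)).
    by apply: lee_nneseries => // n _; have [_ _ /ltW] := KP n.
  by apply: epsilon_trick0; rewrite divr_ge0// ltW.
- exists (L n); split => //.
  rewrite /L -bigcup_mkord; apply: bigcup_sub => i _.
  by have [_ KA _] := KP i; apply: subset_trans KA _; exact: bigcup_sup.
Qed.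

Lemma measurable_closed_regular (p : probability X R) (A : set X) :
  measurable A -> forall eps : R, (0 < eps)%R ->
  exists K, [/\ closed K, f @^-1` K `<=` A & p (A `\` f @^-1` K) < eps%:E].
Proof.
(* Asking for regularity of both a set and its complement makes stability under complements
   automatic; only countable unions and open sets then need an argument. *)
pose G := [set B : set M | [/\ measurable (f @^-1` B),
  closed_regular p B & closed_regular p (~` B)]].
have GE : <<s [set U : set M | open U] >> `<=` G.
  apply: smallest_sub; last first.
    move=> U oU; split; first exact: measurable_preimage_open.
      exact: closed_regular_open.
    move=> eps eps0; exists (~` U); split => //; first exact: open_closedC.
    by rewrite setDv preimage_set0 measure0 lte_fin.
  split.
  - by split; rewrite ?setC0 ?preimage_set0//;
      apply: closed_regular_open; [exact: open0|exact: openT].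
  - move=> B [mB rB rCB]; rewrite setTD; split => //; last by rewrite setCK.
    by rewrite -preimage_setC; exact: measurableC.
  - move=> B GB; split.
    + rewrite preimage_bigcup; apply: bigcupT_measurable => n.
      by have [] := GB n.
    + by apply: closed_regular_bigcup => n; have [] := GB n.
    + rewrite setC_bigcup.
      apply: closed_regular_bigcap => n; have [mB _ rB] := GB n => //.
      by rewrite -preimage_setC; exact: measurableC.
rewrite mX => -[B /GE[_ rB _] <-] eps /rB[K [cK KB ltK]]; exists K.
by rewrite setTI; split => // x; exact: KB.
Qed.

End standard_borel_space.

(** * Countable generation, and covers by small closed sets *)

Section standard_borel_generation.
Context (R : realType) d (X : measurableType d) (M : metricType R) (f : X -> M).
Hypothesis mX : (measurable : set_system X) =
  preimage_set_system [set: X] f <<s [set U : set M | open U] >>.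

Lemma preimage_smallest_sub (G : set_system X) : sigma_algebra setT G ->
  (forall U : set M, open U -> G (f @^-1` U)) -> measurable `<=` G.
Proof.
move=> sG oG; have [G0 GC GU] := sG.
have GE : <<s [set U : set M | open U] >> `<=` [set B | G (f @^-1` B)].
  apply: smallest_sub => //; split => /=.
  - by rewrite preimage_set0.
  - by move=> B GB; rewrite setTD -preimage_setC -setTD; exact: GC.
  - by move=> B GB; rewrite preimage_bigcup; exact: GU.
by rewrite mX => _ [B /GE GB <-]; rewrite setTI.
Qed.

Lemma measurable_fun_preimage_open d' (Y : measurableType d') (s : Y -> X) :
  (forall U : set M, open U -> measurable (s @^-1` (f @^-1` U))) ->
  measurable_fun setT s.
Proof.
move=> sU _ A mA; rewrite setTI.
apply: (preimage_smallest_sub (G := [set A | measurable (s @^-1` A)])) mA => //.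
split => /=.
- by rewrite preimage_set0.
- by move=> B mB; rewrite setTD -preimage_setC; exact: measurableC.
- by move=> B mB; rewrite preimage_bigcup; exact: bigcupT_measurable.
Qed.

(** The system consists of finite intersections of basic balls [V a], enumerated through codes of
    lists. The empty list, also the value at invalid codes, gives the whole space. *)
Lemma countable_pi_system (c : nat -> M) :
  (forall x (eps : R), (0 < eps)%R -> exists j, interior (ball (c j) eps) x) ->
  exists B : nat -> set X, [/\ forall n, measurable (B n),
    setI_closed (range B), range B [set: X] &
    (measurable : set_system X) = <<s range B >>].
Proof.
move=> c_dense.
pose V (a : nat * nat) := interior (ball (c a.1) (a.2.+1%:R^-1 : R)).
pose W (h : seq (nat * nat)) := \big[setI/setT]_(a <- h) V a.
have oW h : open (W h).
  rewrite /W; elim/big_ind : _ => [|A A'|a _]; first exact: openT.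
    exact: openI.
  exact: open_interior.
pose B n := f @^-1` W (odflt [::] (unpickle n)).
have BE h : range B (f @^-1` W h).
  by exists (pickle h) => //; rewrite /B pickleK.
have mB n : measurable (B n) by exact: (measurable_preimage_open mX).
exists B; split => //.
- move=> _ _ [m _ <-] [n _ <-]; rewrite -preimage_setI /W -big_cat.
  exact: BE.
- by have := BE [::]; rewrite /W big_nil preimage_setT.
apply/seteqP; split; last first.
  apply: smallest_sub; first exact: sigma_algebra_measurable.
  by move=> _ [n _ <-].
apply: preimage_smallest_sub; first exact: smallest_sigma_algebra.
move=> U oU.
(* An open set is the union of the basic balls it contains; every other index contributes the empty
   set. *)
pose F n := if unpickle n is Some a then
  if `[< V a `<=` U >] then f @^-1` V a else set0 else set0.
have -> : f @^-1` U = \bigcup_n F n.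
  apply/seteqP; split=> [x Ux|x [n _]]; last first.
    rewrite /F; case: unpickle => // a; case: asboolP => // aU.
    exact: aU.
  have /nbhs_ballP[e /= e0 xeU] : nbhs (f x) U by exact: open_nbhs_nbhs.
  (* Half of [e] suffices: a ball of radius below [e / 2] that contains [f x] lies in the ball of
     radius [e] about [f x]. *)
  have [n ne] := inv_natS_lt (divr_gt0 e0 (ltr0Sn _ 1)).
  have [|j jx] := c_dense (f x) (n.+1%:R^-1)%R; first by rewrite invr_gt0 ltr0n.
  exists (pickle (j, n)) => //; rewrite /F pickleK asboolT//.
  move=> y /interior_subset /= jy; apply: xeU.
  apply: (@ball_splitr _ _ (c j)); apply: (le_ball (ltW ne)) => //.
  exact: interior_subset jx.
apply: sigma_algebra_bigcup => n; rewrite /F.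
case: unpickle => [a|]; last exact: sigma_algebra0.
case: asboolP => _; last exact: sigma_algebra0.
by apply: sub_sigma_algebra; have := BE [:: a]; rewrite /W big_seq1.
Qed.

(** Each ball of radius [1/(n+1)] is cut along [D n], and each piece is approximated from inside by
    closed sets with error [1/(l+1)] for every [l]. The uncovered part of a piece is thus null, and
    there are countably many pieces. *)
Lemma closed_cover (c : nat -> M) (p : probability X R) (D : nat -> set X) :
  (forall x (eps : R), (0 < eps)%R -> exists j, interior (ball (c j) eps) x) ->
  (forall n, measurable (D n)) ->
  exists K : nat -> nat -> set M, [/\ forall n i, closed (K n i),
    forall n i, exists y, f @^-1` K n i `<=` f @^-1` ball y (n.+1%:R^-1 : R),
    forall n i, f @^-1` K n i `<=` D n \/ f @^-1` K n i `<=` ~` D n &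
    forall n, p (~` \bigcup_i f @^-1` K n i) = 0].
Proof.
move=> c_dense mD.
pose A n (a : nat * bool) := f @^-1` interior (ball (c a.1) (n.+1%:R^-1 : R))
  `&` (if a.2 then D n else ~` D n).
have mA n a : measurable (A n a).
  apply: measurableI.
    by apply: (measurable_preimage_open mX); exact: open_interior.
  by case: ifP => _ //; exact: measurableC.
have /choice[K KP] (t : nat * (nat * bool) * nat) : exists K, [/\ closed K,
    f @^-1` K `<=` A t.1.1 t.1.2 &
    p (A t.1.1 t.1.2 `\` f @^-1` K) < (t.2.+1%:R^-1)%:E].
  by apply: (measurable_closed_regular mX) => //; rewrite invr_gt0 ltr0n.
pose L n i := if unpickle i is Some (a, l) then K (n, a, l) else set0.
have mL n i : measurable (f @^-1` L n i).
  apply: (measurable_preimage_closed mX).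
  rewrite /L; case: unpickle => [[a l]|]; last exact: closed0.
  by have [] := KP (n, a, l).
exists L; split.
- move=> n i; rewrite /L; case: unpickle => [[a l]|]; last exact: closed0.
  by have [] := KP (n, a, l).
- move=> n i; rewrite /L; case: unpickle => [[a l]|]; last by exists (c 0%N).
  have [_ KA _] := KP (n, a, l).
  by exists (c a.1); apply: subset_trans KA _ => x [/interior_subset].
- move=> n i; rewrite /L; case: unpickle => [[a l]|]; last first.
    by left; rewrite preimage_set0.
  have [_ KA _] := KP (n, a, l).
  have : f @^-1` K (n, a, l) `<=` if a.2 then D n else ~` D n.
    by apply: subset_trans KA _; exact: subIsetr.
  by case: ifP => _; [left|right].
- move=> n.
  have mU : measurable (\bigcup_i f @^-1` L n i) by exact: bigcupT_measurable.
  apply/negligibleP; first exact: measurableC.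
  pose N a := A n a `\` \bigcup_i f @^-1` L n i.
  have N0 a : p.-negligible (N a).
    have mN : measurable (N a) by exact: measurableD.
    apply/negligibleP => //; apply/eqP; rewrite -measure_le0.
    apply/lee_addgt0Pr => eps eps0; rewrite add0e.
    have [l le] := inv_natS_lt eps0.
    have [cK _ /ltW] := KP (n, a, l); move=> Kl.
    apply: le_trans (le_trans Kl _); last by rewrite lee_fin ltW.
    apply: le_measure; rewrite ?inE//=.
      by apply: measurableD => //; exact: (measurable_preimage_closed mX).
    move=> x [Ax nU]; split => // Kx; apply: nU.
    by exists (pickle (a, l)) => //; rewrite /L /= pickleK.
  apply: (@negligibleS _ _ _ _
      (\bigcup_j N (j, true) `|` \bigcup_j N (j, false))).
    move=> x nU; have [|j jx] := c_dense (f x) (n.+1%:R^-1)%R.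
      by rewrite invr_gt0 ltr0n.
    by have [Dx|nDx] := pselect (D n x); [left|right]; exists j.
  by apply: negligibleU; apply: negligible_bigcup.
Qed.

End standard_borel_generation.

(** * Nested cells of positive measure, chosen by least index *)

(** The value is 0 when no index satisfies [P]. *)
Definition first_index (P : nat -> Prop) : nat :=
  xget 0%N [set i | P i /\ forall j, (j < i)%N -> ~ P j].

Lemma exists_least (P : nat -> Prop) :
  (exists i, P i) -> exists i, P i /\ forall j, (j < i)%N -> ~ P j.
Proof.
move=> [i Pi]; have exP : exists i, `[< P i >] by exists i; apply/asboolP.
exists (ex_minn exP); case: ex_minnP => j /asboolP Pj jP; split => // k.
by move=> kj /asboolP /jP; rewrite leqNgt kj.
Qed.

Lemma first_indexP (P : nat -> Prop) : (exists i, P i) -> P (first_index P).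
Proof.
move=> /exists_least[i Pi]; rewrite /first_index.
by case: xgetP => [_ _ []//|/(_ i)].
Qed.

(** Rewrites the choice as countably many conditions on the [P j], the form in which its
    measurability can be checked. The second disjunct is the default value. *)
Lemma first_indexE (P : nat -> Prop) i :
  first_index P = i <->
  (P i /\ forall j, (j < i)%N -> ~ P j) \/ (i = 0%N /\ forall j, ~ P j).
Proof.
rewrite /first_index; case: xgetP => [k _ [Pk kP]|nP]; split.
- by move=> <-; left.
- case=> [[Pi iP]|[_ /(_ k)]//].
  by case: (ltngtP k i) => // [/iP|/kP].
- move=> <-; right; split => // j Pj.
  by have [k /nP] := exists_least (ex_intro _ j Pj).
- by case=> [Pi|[->]]//; have := nP i.
Qed.

Section nested_cells.
Context (R : realType) d (X : measurableType d) (C : nat -> nat -> set X).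
Hypothesis mC : forall n i, measurable (C n i).

(** Histories are stored with the latest choice first, so the head of
    [i :: h'] is the index chosen at stage [size h']. *)
Fixpoint cell (h : seq nat) : set X :=
  if h is i :: h' then cell h' `&` C (size h') i else setT.

Definition next_index (m : set X -> \bar R) (h : seq nat) : nat :=
  first_index (fun i => 0 < m (cell (i :: h))).

Fixpoint history (m : set X -> \bar R) (n : nat) : seq nat :=
  if n is n'.+1 then next_index m (history m n') :: history m n' else [::].

Lemma measurable_cell h : measurable (cell h).
Proof. by elim: h => [|i h IH] //=; exact: measurableI. Qed.

Lemma size_history m n : size (history m n) = n.
Proof. by elim: n => //= n ->. Qed.

Lemma subset_cell_history m n k :
  (n <= k)%N -> cell (history m k) `<=` cell (history m n).
Proof.
move=> /subnK <-; elim: (k - n)%N => [//|l IH].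
by rewrite addSn; apply: subset_trans IH; exact: subIsetl.
Qed.

(** This is why the selected point will depend on [x] only through the measure [e x]. *)
Lemma eq_history (m m' : set X -> \bar R) :
  (forall A, measurable A -> m A = m' A) -> history m = history m'.
Proof.
move=> mm'; apply/funext; elim=> //= n IH; rewrite IH; congr (_ :: _).
congr first_index; apply/funext => i.
by rewrite mm'//; exact: (measurable_cell (i :: _)).
Qed.

(** If every candidate for the next cell were null, the current cell would be covered by countably
    many null sets together with the null set missed by stage [n], against the induction
    hypothesis. *)
Lemma cell_history_gt0 (m : {measure set X -> \bar R}) n :
  0 < m setT -> (forall n, m (~` \bigcup_i C n i) = 0) ->
  0 < m (cell (history m n)).
Proof.
move=> mT m0; elim: n => [//|n IH].
apply: (@first_indexP (fun i => 0 < m (cell (i :: history m n)))).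
apply: contrapT => /forallNP n0; move: IH; apply/negP.
rewrite -leNgt measure_le0.
apply/eqP/negligibleP; first exact: measurable_cell.
apply: (@negligibleS _ _ _ _ (~` (\bigcup_i C n i) `|`
    \bigcup_i cell (i :: history m n))).
  move=> x hx.
  have [[i _ Ci]|nC] := pselect ((\bigcup_i C n i) x); last by left.
  by right; exists i => //=; rewrite size_history.
apply: negligibleU.
  apply/negligibleP; last exact: m0.
  by apply: measurableC; exact: bigcupT_measurable.
apply: negligible_bigcup => i; apply/negligibleP.
  exact: (measurable_cell (i :: _)).
by apply/eqP; rewrite -measure_le0 leNgt; apply/negP; exact: n0.
Qed.

Lemma measurable_history d' (Y : measurableType d') (e : R.-pker Y ~> X) n h :
  measurable [set x | history (e x) n = h].
Proof.
elim: n h => [|n IH] h /=.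
  case: h => [|i h]; last by rewrite (_ : [set _ | _] = set0)// -subset0.
  by rewrite (_ : [set _ | _] = setT)// -subTset.
case: h => [|i h]; first by rewrite (_ : [set _ | _] = set0)// -subset0.
(* With the earlier history frozen at [h], the next index depends on [x] only through kernel values
   at fixed measurable sets. *)
rewrite (_ : [set _ | _] = [set x | history (e x) n = h] `&`
    [set x | next_index (e x) h = i]); last first.
  by apply/seteqP; split => x /= [? ?]; subst => //; split.
apply: measurableI => //.
have mpos j : measurable [set x | 0 < e x (cell (j :: h))].
  rewrite -[X in measurable X]setTI; apply: measurable_lte => //.
  by apply: measurable_kernel; exact: (measurable_cell (j :: h)).
have mneg (Q : set nat) :
    measurable (\bigcap_(j in Q) ~` [set x | 0 < e x (cell (j :: h))]).
  by apply: bigcap_measurableType => j _; exact: measurableC.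
rewrite (_ : [set _ | _] =
    ([set x | 0 < e x (cell (i :: h))] `&`
      \bigcap_(j in `I_i) ~` [set x | 0 < e x (cell (j :: h))]) `|`
    ([set _ | i = 0%N] `&`
      \bigcap_(j in setT) ~` [set x | 0 < e x (cell (j :: h))])); last first.
  apply/seteqP; split=> x /=.
    by move=> /first_indexE[[? iP]|[? iP]]; [left|right]; split => // j _;
      exact: iP.
  move=> xP; apply/first_indexE; case: xP => -[? iP]; [left|right]; split => //.
  exact: (fun j => iP j Logic.I).
apply: measurableU; first exact: measurableI.
apply: measurableI => //; have [i0|/eqP i0] := eqVneq i 0%N.
  by rewrite (_ : [set _ | _] = setT)// -subTset.
by rewrite (_ : [set _ | _] = set0)// -subset0.
Qed.

End nested_cells.

(** * Measurable selection of a point from the measure [e x] *)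

Lemma probability_inhabited (R : realType) d (X : measurableType d)
    (p : probability X R) : exists x : X, True.
Proof.
have [x _] : [set: X] !=set0; last by exists x.
apply/set0P/eqP => X0; have := probability_setT p.
by rewrite X0 measure0 => /eqP; rewrite eq_sym onee_eq0.
Qed.

Lemma ps_hom_null (R : realType) d1 d2 (X : measurableType d1)
    (Y : measurableType d2) (p : probability X R) (q : probability Y R)
    (k : R.-pker X ~> Y) (N : set Y) :
  ps_hom p q k -> measurable N -> q N = 0 -> {ae p, forall x, k x N = 0}.
Proof.
move=> hk mN qN0.
have mk := measurable_kernel k N mN.
have [+ _] := ae_eq_integral_abs p measurableT mk.
case.
  by under eq_integral do rewrite gee0_abs//; rewrite -hk.
by move=> Z [mZ Z0 sZ]; exists Z; split => // x nx; apply: sZ => /= /(_ I).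
Qed.

(** The last clause speaks of [e x]-null sets instead of the position of [x]; invariance of the
    [D t] later turns it into the statement that [s x] and [x] lie on the same side. *)
Lemma kernel_selection (R : realType) d (X : measurableType d)
    (p : probability X R) (e : R.-pker X ~> X) (D : nat -> set X) :
  standard_borel R X -> ps_hom p p e -> (forall t, measurable (D t)) ->
  exists s : X -> X, [/\ measurable_fun setT s,
    forall x x', (forall A, measurable A -> e x A = e x' A) -> s x = s x' &
    {ae p, forall x, forall t, (e x (D t) = 0 -> ~ D t (s x)) /\
                               (e x (~` D t) = 0 -> D t (s x))}].
Proof.
move=> [M [f [[complete_M [S cS dS]] bij_f mX]]] he mD.
have [x0 _] := probability_inhabited p.
have [c c_dense] := separable_sequence (f x0) cS dS.
have [K [cK ballK KD K0]] := closed_cover mX p c_dense mD.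
pose C n i := f @^-1` K n i.
have mC n i : measurable (C n i) by exact: (measurable_preimage_closed mX).
have mU n : measurable (~` \bigcup_i C n i).
  by apply: measurableC; exact: bigcupT_measurable.
(* Where the cover has full [e x]-measure at every stage. As [e] preserves [p], this holds for
   [p]-almost all [x]. *)
pose good x := forall n, e x (~` \bigcup_i C n i) = 0.
pose hist x := history C (e x).
pose idx x n := next_index C (e x) (hist x n).
have histC x n : cell C (hist x n.+1) `<=` C n (idx x n).
  by move=> y; rewrite /hist /= size_history => -[].
have limitP x : good x -> exists y, forall n, C n (idx x n) y.
  move=> gx; have /choice[y yP] n : exists y, cell C (hist x n.+1) y.
    apply/set0P/eqP => cell0.
    have := cell_history_gt0 mC n.+1 _ gx.
    by rewrite -/(hist x _) cell0 measure0 ltxx prob_kernel => /(_ lte01).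
  have yC n k : (n <= k)%N -> C n (idx x n) (y k).
    move=> nk; apply: histC.
    apply: (@subset_cell_history _ _ _ _ _ n.+1 k.+1) => //.
    exact: yP.
  (* From stage [n] on, the points [y k] stay in one ball of radius [1/(n+1)], so their images in
     [M] form a Cauchy sequence. *)
  have [l fl] : exists l : M, f \o y @ \oo --> l.
    apply: complete_M; apply: cauchy_exP => eps eps0.
    have [n ne] := inv_natS_lt eps0.
    have [z zP] := ballK n (idx x n).
    exists z; exists n => // k /= nk; apply: (le_ball (ltW ne)).
    by apply: zP; exact: yC.
  (* Bijectivity of [f] pulls the limit back to [X], and closedness of the chosen sets keeps it in
     each of them. *)
  have [g fg gf] := bij_f; exists (g l) => n; rewrite /C /= gf.
  apply: (closed_cvg (K n (idx x n)) _ _ _ fl) => //.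
  by exists n => // k /= nk; exact: yC.
(* Having [good x] inside the set forces the constant value [x0] at all other points. *)
pose s x := xget x0 [set y | good x /\ forall n, C n (idx x n) y].
have sP x : good x -> forall n, C n (idx x n) (s x).
  move=> gx; rewrite /s; case: xgetP => [_ _ []//|].
  by have [y yP] := limitP x gx; move=> /(_ y) [].
have mgood : measurable good.
  rewrite (_ : good = \bigcap_n [set x | e x (~` \bigcup_i C n i) = 0]);
    last first.
    by apply/seteqP; split => x /= gx n; [move=> _|]; exact: gx.
  apply: bigcapT_measurable => n.
  rewrite -[X in measurable X]setTI; apply: measurable_eqe => //.
  by apply: measurable_kernel; exact: mU.
exists s; split.
- apply: (measurable_fun_preimage_open mX) => U oU.
  (* The chosen sets contain [s x] and shrink in diameter, so for good [x] the point [s x] lies over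
     [U] exactly when some chosen set lies entirely over [U]. This is a countable union over
     histories. *)
  pose P (h : seq nat) :=
    if h is i :: h' then C (size h') i `<=` f @^-1` U else False.
  rewrite (_ : _ @^-1` _ = (good `&`
      \bigcup_(h : seq nat) [set x | P h /\ hist x (size h) = h])
      `|` (~` good `&` [set x | U (f x0)])); last first.
    apply/seteqP; split => x /=.
      have [gx Ux|ngx Ux] := pselect (good x); last first.
        right; split => //; move: Ux; rewrite /s.
        case: xgetP => [_ _ [/ngx]//|].
        by move=> _.
      left; split => //.
      have /nbhs_ballP[eps /= eps0 xeU] : nbhs (f (s x)) U.
        exact: open_nbhs_nbhs.
      have [n ne] := inv_natS_lt (divr_gt0 eps0 (ltr0Sn _ 1)).
      have [z zP] := ballK n (idx x n).
      exists (hist x n.+1) => //=; rewrite size_history; split => //.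
      move=> y /zP zy; apply: xeU; apply: (@ball_splitr _ _ z);
        apply: (le_ball (ltW ne)) => //; apply: zP; exact: sP.
    move=> [[gx [h _ [+ +]]]|[ngx Ux0]]; last first.
      by rewrite /s; case: xgetP => [_ _ [/ngx]//|].
    case: h => [//|i h] /= hU hE.
    apply: hU; have := sP x gx (size h).
    by move: hE; rewrite /idx /hist /= => -[-> _].
  apply: measurableU.
    apply: measurableI => //; apply: countable_bigcupT_measurable => // h.
    have [Ph|nPh] := pselect (P h); last first.
      by rewrite (_ : [set _ | _] = set0)// -subset0 => x [].
    rewrite (_ : [set _ | _] = [set x | hist x (size h) = h]); last first.
      by apply/seteqP; split => x //= [].
    exact: measurable_history.
  apply: measurableI; first exact: measurableC.
  have [Ux0|nUx0] := pselect (U (f x0)).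
    by rewrite (_ : [set _ | _] = setT)// -subTset.
  by rewrite (_ : [set _ | _] = set0)// -subset0.
- move=> x x' xx'; rewrite /s; congr xget; apply/funext => y; apply/propext.
  have -> : idx x = idx x'.
    apply/funext => n.
    exact: (congr1 (fun h => head 0%N (h n.+1)) (eq_history mC xx')).
  suff -> : good x = good x' by [].
  by apply/propext; split => gx n; rewrite -(gx n) xx'.
- have good_ae : {ae p, forall x, good x}.
    apply: ae_foralln => n; apply: (ps_hom_null he) => //.
    exact: K0.
  apply: filterS good_ae => x gx t.
  (* The set chosen at stage [t] lies on one side of [D t] and contains [s x]; having positive
     measure, it cannot lie on a null side. *)
  have Cpos : 0 < e x (C t (idx x t)).
    have := cell_history_gt0 mC t.+1 _ gx; rewrite prob_kernel => /(_ lte01).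
    move=> /lt_le_trans; apply; apply: le_measure; rewrite ?inE//.
      exact: measurable_cell.
    exact: histC.
  have null A : measurable A -> C t (idx x t) `<=` A -> e x A <> 0.
    move=> mA CA A0; move: Cpos; rewrite ltNge => /negP; apply.
    by rewrite -A0; apply: le_measure; rewrite ?inE.
  have := sP x gx t; have [CD|CD] := KD t (idx x t) => Cs; split => // e0.
  + by exfalso; apply: (null (D t)).
  + exact: CD.
  + exact: CD.
  + by exfalso; apply: (null (~` D t)) => //; exact: measurableC.
Qed.

(** * Invariance of the level sets of an idempotent kernel *)

(** Viewing [p] as a kernel out of [unit] makes [q] the composite of [p] and [k], and the formula
    becomes integration against a composite kernel. *)
Lemma integral_ps_hom (R : realType) d1 d2 (X : measurableType d1)
    (Y : measurableType d2) (p : probability X R) (q : probability Y R)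
    (k : R.-pker X ~> Y) (h : Y -> \bar R) :
  ps_hom p q k -> (forall y, 0 <= h y) -> measurable_fun [set: Y] h ->
  \int[q]_y h y = \int[p]_x \int[k x]_y h y.
Proof.
move=> hk h0 mh.
pose l := kprobability (@measurable_cst _ _ unit _ setT (p : pprobability X R)).
have := integral_kcomp l (kernel.kernel_snd (T0 := unit) k) tt h0 mh.
rewrite /= => <-.
by apply: eq_measure_integral => A mA _; exact: hk.
Qed.

(** The integrals agree over every measurable [A]: the inequality over the complement of [A] can be
    cancelled because [v] is integrable. *)
Lemma ae_eq_le_integral (R : realType) d (X : measurableType d)
    (mu : {measure set X -> \bar R}) (u v : X -> \bar R) :
  (forall x, 0 <= u x) -> measurable_fun [set: X] u ->
  (forall x, 0 <= v x) -> mu.-integrable setT v ->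
  {ae mu, forall x, u x <= v x} -> \int[mu]_x v x <= \int[mu]_x u x ->
  {ae mu, forall x, u x = v x}.
Proof.
move=> u0 mu_ v0 iv uv vu.
have mv := measurable_int _ iv.
have uvA A : measurable A -> \int[mu]_(x in A) u x <= \int[mu]_(x in A) v x.
  move=> mA; apply: ae_ge0_le_integral => //; do ?exact: measurable_funTS.
  by apply: filterS uv => x uvx _.
have splitI w A :
    (forall x, 0 <= w x) -> measurable_fun [set: X] w -> measurable A ->
    \int[mu]_x w x = \int[mu]_(x in A) w x + \int[mu]_(x in ~` A) w x.
  move=> w0 mw mA; rewrite -ge0_integral_setU ?setUv//.
  - exact: measurableC.
  - by apply/disj_setPS; rewrite setICr.
have voo : \int[mu]_x v x < +oo.
  by case/integrableP : iv => _; under eq_integral do rewrite gee0_abs//.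
have eqA A : measurable A -> \int[mu]_(x in A) v x = \int[mu]_(x in A) u x.
  move=> mA; apply/eqP; rewrite eq_le uvA// andbT.
  move: vu; rewrite (splitI v A)// (splitI u A)// => vu.
  have fv : \int[mu]_(x in ~` A) v x \is a fin_num.
    rewrite ge0_fin_numE; last exact: integral_ge0.
    apply: le_lt_trans voo; apply: ge0_subset_integral => //.
    exact: measurableC.
  rewrite -(leeD2rE _ _ fv); apply: (le_trans vu); apply: leeD2l.
  by apply: uvA; exact: measurableC.
have : ae_eq mu setT v u.
  by apply: integral_ae_eq => // A _ mA; exact: eqA.
by apply: filterS => x /(_ I) ->.
Qed.

Lemma integrable_bounded1 (R : realType) d (X : measurableType d)
    (p : probability X R) (u : X -> \bar R) :
  measurable_fun [set: X] u -> (forall x, 0 <= u x) -> (forall x, u x <= 1) ->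
  p.-integrable setT u.
Proof.
move=> mu u0 u1; apply: (le_integrable measurableT mu _
  (finite_measure_integrable_cst p 1 measurableT)) => x _.
by rewrite /= gee0_abs// normr1.
Qed.

Lemma pker_setC (R : realType) d1 d2 (X : measurableType d1)
    (Y : measurableType d2) (k : R.-pker X ~> Y) x (A : set Y) :
  measurable A -> k x A + k x (~` A) = 1.
Proof.
move=> mA; rewrite -(prob_kernel (s := k) x) -measureU ?setUv ?setICr//.
exact: measurableC.
Qed.

Lemma pker_le1 (R : realType) d1 d2 (X : measurableType d1)
    (Y : measurableType d2) (k : R.-pker X ~> Y) x (A : set Y) :
  measurable A -> k x A <= 1.
Proof.
by move=> mA; rewrite -(pker_setC k x mA) leeDl.
Qed.

Section idempotent.
Context (R : realType) d (X : measurableType d) (p : probability X R)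
  (e : R.-pker X ~> X).
Hypothesis he : ps_hom p p e.
Hypothesis idem : as_eq p (pker_comp e e) e.

Lemma idempotent_ae (B : set X) : measurable B ->
  {ae p, forall x, \int[e x]_y e y B = e x B}.
Proof.
move=> mB; have mf := measurable_kernel e B mB.
have mTf := measurable_kernel (pker_comp e e) B mB.
have : ae_eq p setT (fun x => pker_comp e e x B) (fun x => e x B).
  apply: integral_ae_eq => //.
    apply: integrable_bounded1 => // x; exact: pker_le1.
  by move=> A _ mA; exact: idem.
by apply: filterS => x /(_ I).
Qed.

(** The positive part [g] satisfies [g <= Tg] almost everywhere, while [g] and [Tg] have the same
    [p]-integral; hence [g = Tg]. This settles the points outside [D], and comparing [e x D] with
    the indicator of [D] settles the others. *)
Lemma idempotent_level (B : set X) (r : R) : measurable B ->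
  let D := [set x | r%:E < e x B] in
  {ae p, forall x, (D x -> e x (~` D) = 0) /\ (~ D x -> e x D = 0)}.
Proof.
move=> mB D; have mf := measurable_kernel e B mB.
have mD : measurable D.
  by rewrite -[D]setTI; apply: measurable_lte.
(* For negative [r] the level set is everything; below, [0 <= r] gives the bound of [g x] by
   [e x B]. *)
have [r0|r0] := ltP r 0%R.
  have -> : D = setT.
    rewrite -subTset => x _; rewrite /D /=.
    by apply: lt_le_trans (measure_ge0 _ _); rewrite lte_fin.
  by apply: aeW => x; rewrite setCT measure0; split => // /(_ Logic.I).
pose g x := maxe (e x B - r%:E) 0.
have g0 x : 0 <= g x by rewrite /g le_max lexx orbT.
have mg : measurable_fun [set: X] g.
  by apply: measurable_maxe => //; apply: emeasurable_funB.
have gf x : g x <= e x B.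
  rewrite /g ge_max measure_ge0 andbT leeBlDr//.
  by rewrite leeDl// lee_fin.
have fg x : e x B <= g x + r%:E.
  by rewrite -leeBlDr// /g le_max lexx.
have Tmono (u v : X -> \bar R) x : (forall y, 0 <= u y) ->
    measurable_fun [set: X] u -> measurable_fun [set: X] v ->
    (forall y, u y <= v y) ->
    \int[e x]_y u y <= \int[e x]_y v y.
  by move=> u0 mu mv uv; apply: ge0_le_integral.
pose Tg x := \int[e x]_y g y.
have mTg : measurable_fun [set: X] Tg.
  apply: measurable_fun_integral_kernel => // U mU; exact: measurable_kernel.
have Tg0 x : 0 <= Tg x by apply: integral_ge0.
have Tg1 x : Tg x <= 1.
  apply: (@le_trans _ _ (\int[e x]_y (cst 1 y))).
    by apply: Tmono => // y; apply: le_trans (gf y) _; exact: pker_le1.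
  by rewrite integral_cst// mul1e prob_kernel.
have gTg : {ae p, forall x, g x = Tg x}.
  apply: ae_eq_le_integral => //.
  - exact: integrable_bounded1.
  - apply: filterS (idempotent_ae mB) => x Tf.
    rewrite {1}/g ge_max Tg0 andbT leeBlDr// -Tf.
    (* Since [e x] has mass one, integrating [f <= g + r] gives [Tf <= Tg + r], where [Tf = f] by
       idempotence. *)
    apply: (@le_trans _ _ (\int[e x]_y (g y + cst r%:E y))).
      by apply: Tmono => //; exact: emeasurable_funD.
    rewrite ge0_integralD// ?lee_fin// integral_cst//.
    by rewrite prob_kernel mule1.
  - by rewrite -(integral_ps_hom he).
(* Outside [D], [Tg x = g x = 0], so [g] vanishes [e x]-almost everywhere, whereas [g] is positive
   on [D]. *)
have D0 : {ae p, forall x, ~ D x -> e x D = 0}.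
  apply: filterS gTg => x gx nDx.
  have gx0 : g x = 0.
    apply/eqP; rewrite eq_le g0 andbT /g ge_max lexx andbT leeBlDr// add0e.
    by rewrite leNgt; apply/negP.
  have [+ _] := ae_eq_integral_abs (e x) measurableT mg.
  case.
    under eq_integral do rewrite gee0_abs//.
    by rewrite -[RHS]gx0 gx.
  move=> Z [mZ Z0 sZ]; apply/eqP; rewrite -measure_le0 -Z0; apply: le_measure.
  - by rewrite inE.
  - by rewrite inE.
  - move=> y Dy; apply: sZ => /= /(_ I) gy0.
    move: (fg y); rewrite gy0 add0e leNgt => /negP; exact.
(* By [D0] the left side is at most the indicator almost everywhere, and both integrate to [p D]. *)
have DE : {ae p, forall x, e x D = (\1_D x)%:E}.
  apply: ae_eq_le_integral => //.
  - exact: measurable_kernel.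
  - apply: integrable_bounded1.
    + exact/measurable_EFinP/measurable_indic.
    + by move=> x; rewrite lee_fin.
    + by move=> x; rewrite lee_fin indicE; case: (x \in D).
  - apply: filterS D0 => x Dx; rewrite indicE.
    have [xD|/negP xD] := boolP (x \in D); first exact: pker_le1.
    by rewrite Dx//; apply: contra_not xD; rewrite inE.
  - have peD := he mD.
    by rewrite integral_indic// setIT -peD.
apply: filterS2 D0 DE => x Dx DEx; split => // xD.
have := pker_setC e x mD; rewrite DEx indicE mem_set//= => eC.
by apply/eqP; rewrite -measure_le0 -(@leeD2lE _ 1%:E)// eC adde0.
Qed.

End idempotent.

(** * Construction of the splitting *)

Lemma eq_pker_pi_system (R : realType) d (X : measurableType d)
    (e : R.-pker X ~> X) (B : nat -> set X) x y :
  (forall n, measurable (B n)) -> setI_closed (range B) ->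
  range B [set: X] -> (measurable : set_system X) = <<s range B >> ->
  (forall n (r : rat), (ratr r)%:E < e x (B n) <-> (ratr r)%:E < e y (B n)) ->
  forall A, measurable A -> e x A = e y A.
Proof.
move=> mB BI BT sB xy A mA.
have fin z n : e z (B n) \is a fin_num.
  by rewrite ge0_fin_numE// (le_lt_trans (pker_le1 e z (mB n)))// ltry.
have le_rat z z' : (forall n (r : rat), (ratr r)%:E < e z (B n) ->
    (ratr r)%:E < e z' (B n)) -> forall n, e z (B n) <= e z' (B n).
  move=> zz' n; rewrite leNgt; apply/negP.
  rewrite -(fineK (fin z n)) -(fineK (fin z' n)) lte_fin => /rat_in_itvoo[r].
  rewrite in_itv /= => /andP[z'r rz]; have := zz' n r.
  rewrite -(fineK (fin z n)) -(fineK (fin z' n)) !lte_fin => /(_ rz).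
  by move=> /(lt_trans z'r); rewrite ltxx.
apply: (measure_unique (range B) (fun=> setT)) => //.
- by rewrite bigcup_const.
- move=> _ [n _ <-]; apply/eqP; rewrite eq_le.
  by rewrite !le_rat// => k r /xy.
- by move=> _; rewrite prob_kernel ltry.
Qed.

Lemma ae_eq_ge0_integral (R : realType) d (X : measurableType d)
    (mu : {measure set X -> \bar R}) (A : set X) (u v : X -> \bar R) :
  measurable A -> measurable_fun [set: X] u -> measurable_fun [set: X] v ->
  (forall x, 0 <= u x) -> (forall x, 0 <= v x) ->
  {ae mu, forall x, u x = v x} ->
  \int[mu]_(x in A) u x = \int[mu]_(x in A) v x.
Proof.
move=> mA mu_ mv u0 v0 uv; apply: ge0_ae_eq_integral => //.
- exact: measurable_funTS.
- exact: measurable_funTS.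
- by apply: filterS uv => x uvx _.
Qed.

(** Here [q] is the law of [s] under [p], [pi] the Dirac kernel of [s], and [iota] is [e]. Then
    [iota] after [pi] sends [x] to [e (s x)], which the first almost sure hypothesis identifies with
    [e x]; [pi] after [iota] sends [x] to the law of [s] under [e x], and at the points [s x] both
    hypotheses make it the Dirac mass there. *)
Lemma split_through_selection (R : realType) d (X : measurableType d)
    (p : probability X R) (e : R.-pker X ~> X) (s : X -> X) :
  ps_hom p p e -> measurable_fun [set: X] s ->
  {ae p, forall x, forall A, measurable A -> e (s x) A = e x A} ->
  {ae p, forall x, forall A, measurable A ->
    e x (s @^-1` A) = (\1_A (s x))%:E} ->
  exists (q : probability X R) (pi iota : R.-pker X ~> X),
    [/\ ps_hom p q pi, ps_hom q p iota, as_eq p (pker_comp iota pi) e &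
        as_eq q (pker_comp pi iota) (pker_id X R)].
Proof.
move=> he ms es e_fiber.
have mspre A : measurable A -> measurable (s @^-1` A).
  by move=> mA; rewrite -[X in measurable X]setTI; exact: ms.
have mdirac A : measurable A ->
    measurable_fun [set: X] (fun x => (\1_A x)%:E : \bar R).
  by move=> mA; exact/measurable_EFinP/measurable_indic.
have me A : measurable A -> measurable_fun [set: X] (fun x => e x A).
  by move=> mA; exact: measurable_kernel.
have mes A : measurable A -> measurable_fun [set: X] (fun x => e (s x) A).
  by move=> mA; exact: (measurableT_comp (me A mA) ms).
pose sm : {mfun X >-> X} := HB.pack s (isMeasurableFun.Build _ _ _ _ _ ms).
have int_q A (u : X -> \bar R) : measurable A -> measurable_fun [set: X] u ->
    (forall x, 0 <= u x) ->
    \int[distribution p sm]_(x in A) u x = \int[p]_(x in s @^-1` A) u (s x).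
  move=> mA mu u0; rewrite /distribution ge0_integral_pushforward//.
  exact: measurable_funTS.
exists (distribution p sm), (kdirac ms), e; split.
- move=> B mB; rewrite /kdirac /dirac /=.
  rewrite (_ : (fun _ => _) = (fun x => (\1_(s @^-1` B) x)%:E)) //.
  by rewrite integral_indic//= ?setIT//; exact: mspre.
- move=> B mB; rewrite int_q//; last exact: me.
  rewrite preimage_setT -(ae_eq_ge0_integral (u := fun x => e x B))//.
  + exact: he.
  + exact: me.
  + exact: mes.
  + by apply: filterS es => x ->.
- move=> A B mA mB.
  rewrite (eq_integral (fun x => e (s x) B)); last first.
    move=> x _; rewrite /pker_comp /= /mkcomp_noparam /kcomp_noparam /kdirac.
    rewrite integral_dirac//; last exact: me.
    by rewrite diracT mul1e.
  apply: ae_eq_ge0_integral => //; [exact: mes|exact: me|].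
  by apply: filterS es => x ->.
- move=> A B mA mB.
  rewrite (eq_integral (fun x => e x (s @^-1` B))); last first.
    move=> x _; rewrite /pker_comp /= /mkcomp_noparam /kcomp_noparam /kdirac.
    rewrite -[LHS]/(\int[e x]_y (\1_(s @^-1` B) y)%:E).
    by rewrite integral_indic//= ?setIT//; exact: mspre.
  rewrite [RHS](_ : _ = \int[distribution p sm]_(x in A) (\1_B x)%:E)//.
  have meB : measurable_fun [set: X] (fun x => e x (s @^-1` B)).
    by apply: me; exact: mspre.
  rewrite (int_q A _ mA meB)// (int_q A _ mA (mdirac B mB)); last first.
    by move=> x; rewrite lee_fin.
  apply: ae_eq_ge0_integral => //.
  + exact: mspre.
  + by apply: mes; exact: mspre.
  + exact: (measurableT_comp (mdirac B mB) ms).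
  + by apply: filterS2 es e_fiber => x esx ex; rewrite esx ?ex//; exact: mspre.
Qed.

Theorem theorem3p14 (R : realType) (d : measure_display)
    (X : measurableType d) (p : probability X R) (hX : standard_borel R X)
    (e : R.-pker X ~> X) (he : ps_hom p p e)
    (idem : as_eq p (pker_comp e e) e) :
  exists (d' : measure_display) (E : measurableType d') (q : probability E R)
    (pi : R.-pker X ~> E) (iota : R.-pker E ~> X),
    [/\ standard_borel R E, ps_hom p q pi, ps_hom q p iota,
        as_eq p (pker_comp iota pi) e &
        as_eq q (pker_comp pi iota) (pker_id E R)].
Proof.
have [B [mB BI BT sB]] : exists B : nat -> set X, [/\
    forall n, measurable (B n), setI_closed (range B), range B [set: X] &
    (measurable : set_system X) = <<s range B >>].
  have [M [f [[_ [S cS dS]] _ mX]]] := hX.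
  have [x0 _] := probability_inhabited p.
  have [c c_dense] := separable_sequence (f x0) cS dS.
  exact: (countable_pi_system mX c_dense).
(* Indices that encode no pair fall back to the pair [(0, 0)], which only repeats a level set. *)
pose D t := let a := odflt (0%N, 0%R) (unpickle t : option (nat * rat)) in
  [set x | (ratr a.2)%:E < e x (B a.1)].
have DE n r : exists t, D t = [set x | (ratr r)%:E < e x (B n)].
  by exists (pickle (n, r)); rewrite /D pickleK.
have mD t : measurable (D t).
  rewrite -[D t]setTI; apply: measurable_lte => //.
  by apply: measurable_kernel; exact: mB.
have eqD x y : (forall t, D t x <-> D t y) ->
    forall A, measurable A -> e x A = e y A.
  move=> xy; apply: (eq_pker_pi_system (B := B)) => // n r.
  by have [t Dt] := DE n r; have := xy t; rewrite Dt.
have [s [ms s_eq sD]] := kernel_selection hX he mD.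
have Dinv : {ae p, forall x, forall t,
    (D t x -> e x (~` D t) = 0) /\ (~ D t x -> e x (D t) = 0)}.
  by apply: ae_foralln => t; exact: (idempotent_level he idem).
have es : {ae p, forall x, forall A, measurable A -> e (s x) A = e x A}.
  apply: filterS2 sD Dinv => x sDx Dx; apply: eqD => t.
  have [nD sDt] := sDx t; have [DC0 D0] := Dx t.
  split => [|/DC0/sDt//]; apply: contraPP => /D0 /nD; exact.
have e_fiber : {ae p, forall x, forall A, measurable A ->
    e x (s @^-1` A) = (\1_A (s x))%:E}.
  apply: filterS Dinv => x Dx.
  (* [N] collects, for each [t], the [e x]-null side of [D t]. A point [y] outside [N] lies in the
     same [D t] as [x], so [e y] and [e x] agree and [s y = s x]. *)
  pose N := \bigcup_t (if pselect (D t x) then ~` D t else D t).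
  have N0 : (e x).-negligible N.
    apply: negligible_bigcup => t.
    case: pselect => xD; apply/negligibleP.
    + exact: measurableC.
    + exact: (Dx t).1.
    + exact: mD.
    + exact: (Dx t).2.
  have sN y : ~ N y -> s y = s x.
    move=> nNy; apply: s_eq; apply: eqD => t.
    have : ~ (if pselect (D t x) then ~` D t else D t) y.
      by move=> yt; apply: nNy; exists t.
    by case: pselect => xD /= yD; split => // _; apply: contrapT.
  have mspre A : measurable A -> measurable (s @^-1` A).
    by move=> mA; rewrite -[X in measurable X]setTI; exact: ms.
  have s0 A : measurable A -> ~ A (s x) -> e x (s @^-1` A) = 0.
    move=> mA nA; apply/negligibleP; first exact: mspre.
    apply: negligibleS N0 => y Ay; apply: contrapT => /sN sxy.
    by apply: nA; rewrite -sxy.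
  move=> A mA; rewrite indicE.
  have [/set_mem Asx|/negP nA] := boolP (s x \in A); last first.
    by rewrite s0// => Asx; apply: nA; rewrite inE.
  rewrite -(pker_setC e x (mspre _ mA)) preimage_setC (s0 (~` A)) ?adde0//.
  exact: measurableC.
have [q [pi [iota [hpi hiota ip pii]]]] :=
  split_through_selection he ms es e_fiber.
by exists d, X, q, pi, iota.
Qed.
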